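(* Let $n\geq 0$ be an integer and $x$ a complex number (with $x^2\neq 1$ in the second identity). Then $$\sum_{k=0}^{n-1}\binom{n}{k}\bigl(\sqrt{x^2+4}\bigr)^{n-1-k}\bigl(1-(-1)^{n-k}\bigr)T_k(x)= \sum_{k=1}^{n}\binom{n}{k}2^{k-1}\bigl(\sqrt{x^2-1}\bigr)^{n-k}\bigl(1+(-1)^{n-k}\bigr)F_k(x)$$ and $$\sum_{k=0}^{n-1}\binom{n}{k}\bigl(\sqrt{x^2+4}\bigr)^{n-1-k}\bigl(1-(-1)^{n-k}\bigr)U_k(x)= \sum_{k=1}^{n}\binom{n}{k}2^{k-1}\bigl(\sqrt{x^2-1}\bigr)^{n-1-k}\bigl(\alpha(x)-(-1)^{n-k}\beta(x)\bigr)F_k(x).$$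
   Context: The Chebyshev polynomials of the first kind $T_n(x)$ and of the second kind $U_n(x)$ are defined by $T_0(x)=1$, $T_1(x)=x$, $T_{n+1}(x)=2xT_n(x)-T_{n-1}(x)$, and $U_0(x)=1$, $U_1(x)=2x$, $U_{n+1}(x)=2xU_n(x)-U_{n-1}(x)$ for $n\ge 1$. The (Catalan) Fibonacci polynomials $F_n(x)$ are defined by $F_0(x)=0$, $F_1(x)=1$, $F_n(x)=xF_{n-1}(x)+F_{n-2}(x)$ for $n\geq 2$. Put $\alpha(x)=x+\sqrt{x^2-1}$ and $\beta(x)=x-\sqrt{x^2-1}$. Here $\sqrt{x^2-1}$ and $\sqrt{x^2+4}$ denote fixed complex square roots, the same choice being used throughout. Conventions: $0^0=1$, and a sum whose upper limit is smaller than its lower limit is $0$. *)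

(* Defs.v *)
From HB Require Import structures.
From mathcomp Require Import all_boot all_order all_algebra.
From mathcomp Require Import reals complex.

Set Implicit Arguments.
Unset Strict Implicit.
Unset Printing Implicit Defensive.

Import GRing.Theory.
Local Open Scope ring_scope.

Fixpoint chebyshevT (K : comNzRingType) (n : nat) : {poly K} :=
  match n with
  | 0%N => 1
  | n1.+1 =>
    match n1 with
    | 0%N => 'X
    | n2.+1 => 2%:R *: 'X * chebyshevT K n1 - chebyshevT K n2
    end
  end.

Fixpoint chebyshevU (K : comNzRingType) (n : nat) : {poly K} :=
  match n with
  | 0%N => 1
  | n1.+1 =>
    match n1 with
    | 0%N => 2%:R *: 'X
    | n2.+1 => 2%:R *: 'X * chebyshevU K n1 - chebyshevU K n2
    end
  end.

Fixpoint fibonacci (K : comNzRingType) (n : nat) : {poly K} :=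
  match n with
  | 0%N => 0
  | n1.+1 =>
    match n1 with
    | 0%N => 1
    | n2.+1 => 'X * fibonacci K n1 + fibonacci K n2
    end
  end.

(* In alpha and beta, the argument r is the chosen square root of x ^+ 2 - 1. *)
Definition alpha (K : comNzRingType) (x r : K) : K := x + r.
Definition beta (K : comNzRingType) (x r : K) : K := x - r.

(* Main.v *)
Require Import Defs.
From HB Require Import structures.
From mathcomp Require Import all_boot all_order all_algebra.
From mathcomp Require Import reals complex.
From mathcomp Require Import ring zify.

Set Implicit Arguments.
Unset Strict Implicit.
Unset Printing Implicit Defensive.

Import GRing.Theory.
Local Open Scope ring_scope.

(* Put D_n(y) = ((y + s)^n - (y - s)^n) / s, a polynomial in y and s.  With
   s^2 = x^2 + 4, Binet's formula reads 2^k F_k(x) = D_k(x); and T_k, U_k are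
   combinations of powers of alpha = x + r and beta = x - r.  So the left-hand
   sides are combinations of D_n(alpha) and D_n(beta), and the right-hand sides
   become the same combinations by the binomial shift formula
   sum_k C(n,k) r^(n-k) D_k(x) = D_n(x + r), used for r and for -r. *)

(** Expanded as a sum, so that s = 0 is allowed and no division occurs; it is the left-hand side of
    both identities with [y ^+ k] in place of T_k or U_k. *)
Definition symdiff (A : comNzRingType) (n : nat) (y s : A) : A :=
  \sum_(0 <= k < n) 'C(n, k)%:R * s ^+ (n - 1 - k) * (1 - (-1) ^+ (n - k))
    * y ^+ k.

Lemma symdiff0 (A : comNzRingType) (y s : A) : symdiff 0 y s = 0.
Proof. by rewrite /symdiff big_geq. Qed.

Lemma mul_symdiff (A : comNzRingType) n (y s : A) :
  s * symdiff n y s = (y + s) ^+ n - (y - s) ^+ n.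
Proof.
rewrite [y + s]addrC [y - s]addrC !exprDn -sumrB /symdiff mulr_sumr.
(* The term k = n is s^0 - (-s)^0 = 0; for k < n a factor s splits off. *)
rewrite big_ord_recr /= subnn !expr0 subrr addr0 big_mkord.
apply: eq_bigr => k _; have lt_kn := ltn_ord k.
have -> : (n - k = (n - 1 - k).+1)%N by lia.
by rewrite [(- s) ^+ _]exprNn !exprS -mulrnBl -mulr_natl; ring.
Qed.

Lemma rmorph_symdiff (A B : comNzRingType) (f : {rmorphism A -> B}) n (y s : A) :
  f (symdiff n y s) = symdiff n (f y) (f s).
Proof.
rewrite /symdiff rmorph_sum; apply: eq_bigr => k _.
by rewrite !rmorphM rmorphB rmorph1 !rmorphXn rmorphN1 rmorph_nat.
Qed.

(* In the next two lemmas the case s = 0 is covered by replacing s with an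
   indeterminate, which can be cancelled, and then evaluating at s. *)
Lemma symdiff_shift (A : idomainType) n (y r s : A) :
  \sum_(0 <= k < n.+1) 'C(n, k)%:R * r ^+ (n - k) * symdiff k y s
  = symdiff n (y + r) s.
Proof.
have shiftX : \sum_(0 <= k < n.+1)
    'C(n, k)%:R * r%:P ^+ (n - k) * symdiff k y%:P 'X
  = symdiff n (y%:P + r%:P) 'X.
  apply: (mulfI (negbT (polyX_eq0 A))); rewrite mul_symdiff mulr_sumr.
  (* Regrouped as r + (y + 'X) and r + (y - 'X), both powers expand with the same coefficients. *)
  rewrite !(addrAC _ r%:P) ![_ + r%:P]addrC !exprDn -sumrB big_mkord.
  apply: eq_bigr => k _.
  by rewrite mulrCA mul_symdiff -mulrnBl -[RHS]mulr_natl -mulrBr mulrA.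
have := congr1 (horner_eval s) shiftX.
rewrite rmorph_sum rmorph_symdiff rmorphD /= !horner_evalE !hornerC hornerX => <-.
apply: eq_bigr => k _.
by rewrite !rmorphM rmorphXn rmorph_nat rmorph_symdiff /= !horner_evalE !hornerC hornerX.
Qed.

Lemma symdiff_rec (A : idomainType) n (y s : A) :
  symdiff n.+2 y s
  = 2%:R * y * symdiff n.+1 y s + (s ^+ 2 - y ^+ 2) * symdiff n y s.
Proof.
have recX : symdiff n.+2 y%:P 'X = 2%:R * y%:P * symdiff n.+1 y%:P 'X
    + ('X ^+ 2 - y%:P ^+ 2) * symdiff n y%:P 'X.
  apply: (mulfI (negbT (polyX_eq0 A))).
  (* Both y + 'X and y - 'X are roots of t^2 = 2 y t + ('X^2 - y^2). *)
  rewrite mulrDr 2!(mulrCA 'X) !mul_symdiff !exprS; ring.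
have := congr1 (horner_eval s) recX.
rewrite rmorphD !rmorphM rmorphB !rmorphXn rmorph_nat !rmorph_symdiff /=.
by rewrite !horner_evalE !hornerC hornerX.
Qed.

Lemma nat_ind2 (P : nat -> Prop) :
  P 0%N -> P 1%N -> (forall n, P n -> P n.+1 -> P n.+2) -> forall n, P n.
Proof.
move=> P0 P1 PSS n; suff [] : P n /\ P n.+1 by [].
by elim: n => [|n [Pn PSn]]; split=> //; apply: PSS.
Qed.

(** As s^2 - x^2 = 4, [symdiff_rec] at y = x is the recurrence of 2^n F_n(x). *)
Lemma fibonacci_symdiff (A : idomainType) n (x s : A) :
  s ^+ 2 = x ^+ 2 + 4%:R ->
  2%:R ^+ n * (fibonacci A n).[x] = symdiff n x s.
Proof.
move=> hs; elim/nat_ind2: n => [||n IHn IHSn].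
- by rewrite /= horner0 mulr0 symdiff0.
- by rewrite /= hornerC /symdiff big_nat1 bin0 subnn subn0 !expr0 !expr1; ring.
rewrite symdiff_rec hs -IHn -IHSn [fibonacci A n.+2]/=.
by rewrite -/(fibonacci A n.+1) hornerD hornerM hornerX !exprS; ring.
Qed.

(** Since r^2 = x^2 - 1, alpha and beta are the roots of t^2 = 2 x t - 1, the characteristic
    equation of the recurrence. *)
Lemma chebyshevT_alpha_beta (A : comNzRingType) n (x r : A) :
  r ^+ 2 = x ^+ 2 - 1 ->
  2%:R * (chebyshevT A n).[x] = alpha x r ^+ n + beta x r ^+ n.
Proof.
rewrite /alpha /beta => hr; elim/nat_ind2: n => [||n IHn IHSn].
- by rewrite /= hornerC !expr0; ring.
- by rewrite /= hornerX !expr1; ring.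
rewrite [chebyshevT A n.+2]/= -/(chebyshevT A n.+1).
rewrite hornerD hornerN hornerM hornerZ hornerX mulrBr mulrCA IHn IHSn !exprS.
ring: hr.
Qed.

(** Same roots as for T; the factor alpha - beta = 2 r stays on the left to avoid a division. *)
Lemma chebyshevU_alpha_beta (A : comNzRingType) n (x r : A) :
  r ^+ 2 = x ^+ 2 - 1 ->
  2%:R * r * (chebyshevU A n).[x] = alpha x r ^+ n.+1 - beta x r ^+ n.+1.
Proof.
rewrite /alpha /beta => hr; elim/nat_ind2: n => [||n IHn IHSn].
- by rewrite /= hornerC !expr1; ring.
- by rewrite /= hornerZ hornerX; ring.
rewrite [chebyshevU A n.+2]/= -/(chebyshevU A n.+1).
rewrite hornerD hornerN hornerM hornerZ hornerX mulrBr mulrCA IHn IHSn !exprS.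
ring: hr.
Qed.

(* The term k = 0 vanishes because F_0 = 0. *)
Lemma fibonacci_sum_symdiff (A : idomainType) n (x s : A) (c : nat -> A) :
  s ^+ 2 = x ^+ 2 + 4%:R ->
  2%:R * \sum_(1 <= k < n.+1) c k * 2%:R ^+ (k - 1) * (fibonacci A k).[x]
  = \sum_(0 <= k < n.+1) c k * symdiff k x s.
Proof.
move=> hs; rewrite [RHS]big_ltn // symdiff0 mulr0 add0r mulr_sumr.
apply: eq_big_nat => -[//|k] _; rewrite -(fibonacci_symdiff k.+1 hs) subn1 /=.
by rewrite exprS; ring.
Qed.

Theorem theorem5 (R : realType) (n : nat) (x s r : R[i])
    (hs : s ^+ 2 = x ^+ 2 + 4%:R) (hr : r ^+ 2 = x ^+ 2 - 1) :
  (\sum_(0 <= k < n) 'C(n, k)%:R * s ^+ (n - 1 - k)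
       * (1 - (-1) ^+ (n - k)) * (chebyshevT R[i] k).[x]
   = \sum_(1 <= k < n.+1) 'C(n, k)%:R * 2%:R ^+ (k - 1) * r ^+ (n - k)
       * (1 + (-1) ^+ (n - k)) * (fibonacci R[i] k).[x])
  /\
  (x ^+ 2 <> 1 ->
   \sum_(0 <= k < n) 'C(n, k)%:R * s ^+ (n - 1 - k)
       * (1 - (-1) ^+ (n - k)) * (chebyshevU R[i] k).[x]
   = \sum_(1 <= k < n.+1) 'C(n, k)%:R * 2%:R ^+ (k - 1)
       * r ^ (n%:Z - 1 - k%:Z)
       * (alpha x r - (-1) ^+ (n - k) * beta x r) * (fibonacci R[i] k).[x]).
Proof.
have two_neq0 : 2%:R != 0 :> R[i] by rewrite Num.Theory.pnatr_eq0.
(* The signs come from shifting x by -r. *)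
have shiftN : \sum_(0 <= k < n.+1) 'C(n, k)%:R * ((-1) ^+ (n - k) * r ^+ (n - k))
    * symdiff k x s = symdiff n (beta x r) s.
  by rewrite -symdiff_shift; apply: eq_bigr => k _; rewrite -exprNn.
split=> [|x_neq].
  (* Doubling turns T_k into alpha^k + beta^k on the left and 2^(k-1) into 2^k on the right. *)
  apply: (mulfI two_neq0).
  transitivity (symdiff n (alpha x r) s + symdiff n (beta x r) s).
    rewrite /symdiff -big_split mulr_sumr; apply: eq_bigr => k _ /=.
    by rewrite -mulrDr -chebyshevT_alpha_beta // mulrCA.
  rewrite -shiftN -symdiff_shift -big_split /=.
  under [in RHS]eq_bigr => k _ do
    rewrite -!mulrA [_ ^+ (k - 1) * _]mulrCA [_ ^+ (k - 1) * _]mulrCA !mulrA.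
  rewrite (fibonacci_sum_symdiff n _ hs); apply: eq_bigr => k _; ring.
have r_neq0 : r != 0.
  by apply/eqP => r0; apply: x_neq; apply/eqP; rewrite -subr_eq0 -hr r0 expr0n.
(* The factor 2 r turns U_k into alpha^(k+1) - beta^(k+1) and raises the power of r on the right to
   n - k. *)
apply: (mulfI (mulf_neq0 two_neq0 r_neq0)).
transitivity (alpha x r * symdiff n (alpha x r) s
              - beta x r * symdiff n (beta x r) s).
  rewrite /symdiff !mulr_sumr -sumrB; apply: eq_bigr => k _ /=.
  by rewrite mulrCA chebyshevU_alpha_beta // !exprS; ring.
rewrite -shiftN -symdiff_shift !mulr_sumr -sumrB.
pose c k := 'C(n, k)%:R * r ^+ (n - k) * (alpha x r - (-1) ^+ (n - k) * beta x r).
transitivity (\sum_(0 <= k < n.+1) c k * symdiff k x s).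
  by apply: eq_bigr => k _; rewrite /c /alpha; ring.
rewrite -(fibonacci_sum_symdiff n c hs) mulr_sumr; apply: eq_big_nat => k.
rewrite /c => /andP[_ le_kn].
(* At k = n the integer exponent is -1, hence the appeal to r != 0. *)
have -> : r ^+ (n - k) = r * r ^ (n%:Z - 1 - k%:Z).
  rewrite -[X in X * _]expr1z -expfzDr // exprnP; congr (_ ^ _); lia.
ring.
Qed.
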